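(* Let $X$ and $Y$ be Hausdorff spaces and let $f:X\to Y$ be a continuous surjection that is boundary-compact. Suppose that at least one of the following conditions holds: (1) $X$ has a point-countable base; (2) $X$ is a developable space. Then $f$ is a sequentially quotient map if and only if $f$ is a pseudo-sequence-covering map.
   Context: A map $f:X\to Y$ is *boundary-compact* if for each $y\in Y$ the topological boundary $\partial f^{-1}(y)$ is compact in $X$. $f$ is *sequentially quotient* if whenever $\{y_n\}$ is a convergent sequence in $Y$ there are a subsequence $\{y_{n_k}\}$ and a convergent sequence $\{x_k\}$ in $X$ with $x_k\in f^{-1}(y_{n_k})$ for each $k$. $f$ is *pseudo-sequence-covering* if for each convergent sequence $L$ in $Y$ there is a compact subset $K$ of $X$ such that $f(K)=\overline{L}$ (the closure of the set of terms of $L$, i.e. the terms together with the limit). A base is *point-countable* if each point belongs to at most countably many of its members. A space is *developable* if it has a sequence $\{\mathcal U_n\}_{n\in\mathbb N}$ of open covers such that for each point $x$ the stars $\mathrm{st}(x,\mathcal U_n)=\bigcup\{U\in\mathcal U_n: x\in U\}$, $n\in\mathbb N$, form a neighborhood base at $x$. *)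

(* Defs.v *)
From mathcomp Require Import all_boot all_order all_algebra.
From mathcomp Require Import all_classical all_reals all_analysis.

Set Implicit Arguments.
Unset Strict Implicit.
Unset Printing Implicit Defensive.

Local Open Scope classical_set_scope.

Definition boundary (T : topologicalType) (A : set T) : set T :=
  closure A `\` A°.

Definition boundary_compact (X Y : topologicalType) (f : X -> Y) : Prop :=
  forall y : Y, compact (boundary (f @^-1` [set y])).

(* Convergence is stated with an explicit limit: the library's [cvg] is defined
   from [lim], which requires a pointed space. *)
Definition sequentially_quotient (X Y : topologicalType) (f : X -> Y) : Prop :=
  forall y_ : nat -> Y, (exists y : Y, y_ @ \oo --> y) ->
  exists (phi : nat -> nat) (x_ : nat -> X),
    [/\ increasing_seq phi,
        exists x : X, x_ @ \oo --> x
      & forall k, (f @^-1` [set y_ (phi k)]) (x_ k)].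

Definition pseudo_sequence_covering (X Y : topologicalType) (f : X -> Y)
    : Prop :=
  forall y_ : nat -> Y, (exists y : Y, y_ @ \oo --> y) ->
  exists2 K : set X, compact K & f @` K = closure (range y_).

Definition has_point_countable_base (T : topologicalType) : Prop :=
  exists2 B : set (set T), basis B & forall x : T, countable [set U | B U /\ U x].

Definition open_cover (T : topologicalType) (U : set (set T)) : Prop :=
  U `<=` open /\ \bigcup_(A in U) A = [set: T].

Definition star (T : Type) (x : T) (U : set (set T)) : set T :=
  \bigcup_(A in [set A | U A /\ A x]) A.

(* [nbhs x = filter_from setT V] says that each [V n] is a neighborhood of [x]
   and that each neighborhood of [x] contains some [V n]. *)
Definition developable (T : topologicalType) : Prop :=
  exists2 U : nat -> set (set T), (forall n, open_cover (U n)) &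
    forall x : T, nbhs x = filter_from [set: nat] (fun n => star x (U n)).

(* Main.v *)
(* In both cases every compact K in X has a countable outer base. If B is a
   family of open sets containing a base at each point of K, such that each point
   of K lies in countably many members of B, build finite unions of members of B
   as a countably branching tree: a union W not covering K has as children the
   unions of W with a member of B through a chosen point of K \ W. For an open U
   around K, following the members of a finite cover of K inside U ends at a node
   that covers K and is contained in U. In a developable space, B is the union of
   finite subcovers of K extracted from the covers of the development.

   If y_n --> y and f is sequentially quotient, every neighborhood of the boundary
   of the fiber over y eventually meets the fibers over the y_n <> y. With an
   outer base of this compact boundary one picks x_n over y_n accumulating on it;
   the boundary, one point over y and the x_n form a compact set over the sequence.
   Conversely, outer bases of points make compact sets sequentially compact. *)
Require Import Defs.
From HB Require Import structures.
From mathcomp Require Import all_boot all_order all_algebra.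
From mathcomp Require Import finmap.
From mathcomp Require Import all_classical all_reals all_analysis.

Set Implicit Arguments.
Unset Strict Implicit.
Unset Printing Implicit Defensive.

Local Open Scope classical_set_scope.

(* The library's [compact_cover] requires a pointed space. *)
Lemma compact_coverP (T : topologicalType) (K : set T) :
  compact K <-> cover_compact K.
Proof.
have [->|/set0P[x0 _]] := eqVneq K set0.
  split=> _; last exact: compact0.
  by move=> I D f _ _; exists fset0%fset.
pose pT : ptopologicalType := HB.pack T (isPointed.Build T x0).
suff -> : compact K = cover_compact K by [].
exact: (congr1 (@^~ K) (@compact_cover pT)).
Qed.

(** * Countable outer bases of compact sets *)

Definition outer_base (T : topologicalType) (K : set T) (G : nat -> set T) :=
  [/\ forall n, open (G n), forall n, K `<=` G n
    & forall U, open U -> K `<=` U -> exists n, G n `<=` U].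

(** Countability and the base property are asked only at points of [K], so that [B] may be built
    from [K], as in the developable case. *)
Lemma point_countable_outer_base (T : topologicalType) (K : set T)
    (B : set (set T)) :
  compact K -> B `<=` open ->
  (forall x, K x -> countable [set V | B V /\ V x]) ->
  (forall x U, K x -> open U -> U x -> exists V, [/\ B V, V x & V `<=` U]) ->
  exists G, outer_base K G.
Proof.
move=> Kc Bo Bcount Bbase.
have [K0|/set0P[x0 Kx0]] := eqVneq K set0.
  exists (fun=> set0); rewrite K0.
  by split=> [n|n //|U _ _]; [exact: open0|exists 0].
have /choice[p pP] (W : set T) : exists x, K x /\ (~ K `<=` W -> ~ W x).
  have [KW|/existsNP[x /not_implyP[Kx Wx]]] := pselect (K `<=` W).
    by exists x0.
  by exists x.
have /choice[g gP] x : exists g : set T -> nat,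
    K x -> {in [set V | B V /\ V x] &, injective g}.
  have [Kx|nKx] := pselect (K x); last by exists (fun=> 0).
  by have /countable_injP[g gi] := Bcount x Kx; exists g.
(* For [x] in [K], the member of [B] through [x] numbered [n] by [g x], written as a union so that
   it is empty when no member has that number. *)
pose e x n := \bigcup_(V in [set V | [/\ B V, V x & g x V = n]]) V.
have eg x V : K x -> B V -> V x -> e x (g x V) = V.
  move=> Kx BV Vx; apply/seteqP; split=> [z [V' [BV' V'x gV]]|z Vz].
    by rewrite -(gP x Kx V' V) ?inE.
  by exists V.
pose W := fix W (s : seq nat) :=
  if s is n :: s' then W s' `|` e (p (W s')) n else set0.
have Wo s : open (W s).
  elim: s => [|n s IH] /=; first exact: open0.
  by apply: openU => //; apply: bigcup_open => V [/Bo].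
have Wend U (F : seq (set T)) s :
    (forall V, V \in F -> B V /\ V `<=` U) -> W s `<=` U ->
    K `<=` W s `|` [set x | exists2 V, V \in F & V x] ->
    exists2 s', K `<=` W s' & W s' `<=` U.
  have [m] := ubnP (size F); elim: m F s => // m IH F s Fm FU WU KF.
  have [KW|nKW] := pselect (K `<=` W s); first by exists s.
  have [Kp /(_ nKW) nWp] := pP (W s).
  have [//|[V VF Vp]] := KF _ Kp.
  have [BV VU] := FU _ VF.
  apply: (IH (rem V F) (g (p (W s)) V :: s)).
  - rewrite size_rem //; case: (F) VF Fm => //.
  - by move=> V' /mem_rem /FU.
  - by rewrite /= eg // => x [/WU|/VU].
  - rewrite /= eg // => x /KF [Wx|[V' V'F V'x]]; first by left; left.
    have [<-|V'V] := eqVneq V' V; first by left; right.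
    right; exists V' => //.
    by move: V'F; rewrite (perm_mem (perm_to_rem VF)) inE (negPf V'V).
(* Numbers coding no sequence and unions not covering [K] are sent to [setT], a harmless
   neighborhood of [K]. *)
pose G (o : option (seq nat)) := if o is Some s then
  if `[< K `<=` W s >] then W s else setT else setT.
exists (fun n => G (choice.unpickle n)); split=> [n|n|U Uo KU].
- case: (choice.unpickle n) => [s|] /=; last exact: openT.
  by case: asboolP => // _; exact: openT.
- by case: (choice.unpickle n) => [s|] //=; case: asboolP.
- have Kcov : K `<=` cover [set V | B V /\ V `<=` U] id.
    by move=> x Kx; have [V [BV Vx VU]] := Bbase x U Kx Uo (KU _ Kx); exists V.
  have [|D DU KD] := (compact_coverP K).1 Kc _ _ _ _ Kcov.
    by move=> V [/Bo].
  have [V /DU|//|x /KD[V VD Vx]|s Ks sU] := @Wend U (enum_fset D) [::].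
  - by rewrite inE.
  - by right; exists V.
  - by exists (choice.pickle s); rewrite choice.pickleK /=; case: asboolP.
Qed.

Lemma developable_compact_outer_base (T : topologicalType) (K : set T) :
  developable T -> compact K -> exists G, outer_base K G.
Proof.
move=> [U Ucov Ubase] Kc.
have /choice[D DP] n : exists D : {fset set T},
    {subset D <= U n} /\ K `<=` cover [set` D] id.
  have [Uo UT] := Ucov n.
  have [||D DU KD] := (compact_coverP K).1 Kc _ (U n) id; last by exists D.
  - by move=> V /Uo.
  - by move=> x _; rewrite /cover UT.
apply: (@point_countable_outer_base _ _ (\bigcup_n [set` D n])) => //.
- by move=> V [n _ /(DP n).1]; rewrite inE => /(Ucov n).1.
- move=> x _; apply: (@sub_countable _ _ _ (\bigcup_n [set` D n])).
    by apply: subset_card_le => V [].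
  by apply: bigcup_countable => // n _; exact: countable_fset.
- move=> x V Kx Vo Vx.
  have : nbhs x V by exact: open_nbhs_nbhs.
  rewrite Ubase => -[n _ stV].
  (* Any member of [D n] through [x] lies in the star of [x] in [U n], hence in [V]. *)
  have [A AD Ax] := (DP n).2 _ Kx.
  exists A; split=> //; first by exists n.
  move=> z Az; apply: stV; exists A => //; split=> //.
  by have := (DP n).1 _ AD; rewrite inE.
Qed.

Lemma point_countable_base_compact_outer_base (T : topologicalType)
    (K : set T) :
  has_point_countable_base T -> compact K -> exists G, outer_base K G.
Proof.
move=> [B [Bo Bbase] Bcount] Kc.
apply: (point_countable_outer_base Kc Bo) => [x _|x U _ Uo Ux].
  exact: Bcount.
by have [V [BV Vx] VU] := Bbase x U (open_nbhs_nbhs (conj Uo Ux)); exists V.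
Qed.

Lemma outer_base_decreasing (T : topologicalType) (K : set T)
    (G : nat -> set T) :
  outer_base K G ->
  exists2 H, outer_base K H & forall m n, m <= n -> H n `<=` H m.
Proof.
move=> [Go KG Gbase].
pose H := fix H n := if n is n'.+1 then H n' `&` G n'.+1 else G 0.
have HG n : H n `<=` G n by case: n => //= n x [].
exists H; first split.
- by elim=> [|n IH] /=; [exact: Go|exact: openI].
- by elim=> [|n IH] /= x Kx; [exact: KG|split; [exact: IH|exact: KG]].
- move=> U Uo KU; have [n GU] := Gbase U Uo KU.
  by exists n => x /HG /GU.
- move=> m n /subnK <-; elim: (n - m) => // k IH x /=.
  by move=> [/IH].
Qed.

(** * Subsequences and compactness *)

Lemma increasing_subsequence (P : nat -> nat -> Prop) :
  (forall k N, exists2 n, N <= n & P k n) ->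
  exists2 phi : nat -> nat, increasing_seq phi & forall k, P k (phi k).
Proof.
move=> Pinf.
have /choice[g gP] (kN : nat * nat) :
    exists n, kN.2 <= n /\ P kN.1 n.
  by have [n] := Pinf kN.1 kN.2; exists n.
(* Searching from [(phi k').+1] on makes [phi] strictly increasing. *)
pose phi := fix phi k := if k is k'.+1 then g (k, (phi k').+1) else g (0, 0).
exists phi => [|[|k]]; last 2 first.
- by have [] := gP (0, 0).
- by have [] := gP (k.+1, (phi k).+1).
by apply/increasing_seqP => k; have [] := gP (k.+1, (phi k).+1).
Qed.

Lemma increasing_seq_cvgn (phi : nat -> nat) :
  increasing_seq phi -> phi @ \oo --> \oo.
Proof.
move=> phii A [N _ NA]; exists N => // n /= Nn; apply: NA => /=.
apply: leq_trans Nn _; elim: n => // n; rewrite -ltnS => /leq_trans; apply.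
by move/increasing_seqP : phii; exact.
Qed.

Lemma cluster_subsequence (T : topologicalType) (x_ : nat -> T) (x : T)
    (G : nat -> set T) :
  outer_base [set x] G -> cluster (x_ @ \oo) x ->
  exists2 phi : nat -> nat, increasing_seq phi & x_ \o phi @ \oo --> x.
Proof.
move=> /outer_base_decreasing[H [Ho xH Hbase] Hdec] clx.
(* The sets [H k] decrease, so taking the [k]-th term in [H k] forces convergence to [x]. *)
have [k N|phi phii phiH] := @increasing_subsequence (fun k n => H k (x_ n)).
  have Hx : nbhs x (H k) by apply: open_nbhs_nbhs; split=> //; exact: xH.
  have xN : (x_ @ \oo) (x_ @` [set n | N <= n]) by exists N => // n Nn; exists n.
  by have [_ [[n /= Nn <-] Hn]] := clx _ _ xN Hx; exists n.
exists phi => // V; rewrite nbhsE => -[U [Uo Ux] UV].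
have [|k HU] := Hbase U Uo; first by move=> _ ->.
by exists k => // n /= kn; apply/UV/HU/(Hdec _ _ kn).
Qed.

(** A finite subcover of [C] already contains all but finitely many [x_ n]; the remaining ones form
    a finite set. *)
Lemma compactU_range (T : topologicalType) (C : set T) (x_ : nat -> T) :
  compact C ->
  (forall U, open U -> C `<=` U -> \forall n \near \oo, U (x_ n)) ->
  compact (C `|` range x_).
Proof.
move=> Cc xC; apply/compact_coverP => I D h ho cov.
have [|D1 D1D CD1] := (compact_coverP C).1 Cc I D h ho.
  by move=> x Cx; apply: cov; left.
have [|N _ NU] := xC (cover [set` D1] h) _ CD1.
  by apply: bigcup_open => i /D1D; rewrite inE => /ho.
have Fc : compact (x_ @` `I_N) by exact/finite_compact/finite_image.
have [|D2 D2D FD2] := (compact_coverP _).1 Fc I D h ho.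
  by move=> _ [n _ <-]; apply: cov; right; exists n.
exists (D1 `|` D2)%fset.
  by move=> i; rewrite !inE => /orP[/D1D|/D2D]; rewrite inE.
have D1S : cover [set` D1] h `<=` cover [set` (D1 `|` D2)%fset] h.
  by apply: bigcup_subset => i /= iD1; rewrite inE iD1.
have D2S : cover [set` D2] h `<=` cover [set` (D1 `|` D2)%fset] h.
  by apply: bigcup_subset => i /= iD2; rewrite inE iD2 orbT.
move=> _ [/CD1/D1S //|[n _ <-]].
have [nN|Nn] := ltnP n N; first by apply/D2S/FD2; exists n.
exact/D1S/NU.
Qed.

(** * The two implications *)

Lemma pseudo_sequence_covering_sequentially_quotient (X Y : topologicalType)
    (f : X -> Y) :
  (forall x : X, exists G, outer_base [set x] G) ->
  pseudo_sequence_covering f -> sequentially_quotient f.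
Proof.
move=> Xfc psc y_ cvgy; have [K Kc fK] := psc y_ cvgy.
have /choice[x_ xP] n : exists x, K x /\ f x = y_ n.
  have : closure (range y_) (y_ n) by apply: subset_closure; exists n.
  by rewrite -fK => -[x Kx fx]; exists x.
have Kx : (x_ @ \oo) K by exists 0 => // n _; exact: (xP n).1.
have [x [_ clx]] := Kc _ _ Kx.
have [G xG] := Xfc x.
have [phi phii phix] := cluster_subsequence xG clx.
by exists phi, (x_ \o phi); split=> // [|k]; [exists x|exact: (xP _).2].
Qed.

(* The limit of the lifted subsequence lies over [y] and is approached from
   outside the fiber, hence belongs to its boundary. *)
Lemma fiber_near_boundary (X Y : topologicalType) (f : X -> Y) (y : Y)
    (y_ : nat -> Y) (U : set X) :
  hausdorff_space Y -> continuous f -> sequentially_quotient f ->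
  y_ @ \oo --> y -> open U -> boundary (f @^-1` [set y]) `<=` U ->
  \forall n \near \oo, y_ n = y \/ exists2 x, f x = y_ n & U x.
Proof.
move=> Yh fc sq yy Uo bU; apply: contrapT => nnear.
(* If the claim fails, [phi] selects terms different from [y] whose fibers miss [U]. *)
have [_ N|phi phii phiP] := @increasing_subsequence
    (fun _ n => ~ (y_ n = y \/ exists2 x, f x = y_ n & U x)).
  apply: contrapT => nex; apply: nnear; exists N => // n /= Nn.
  by apply: contrapT => nP; apply: nex; exists n.
have yphi : y_ \o phi @ \oo --> y.
  by apply: cvg_comp yy; exact: increasing_seq_cvgn.
have [psi [x_ [psii [x xx] fx]]] := sq _ (ex_intro _ y yphi).
have fxy : f x = y.
  have fxx : f \o x_ @ \oo --> f x by apply: cvg_comp xx _; exact: fc.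
  have fxy' : f \o x_ @ \oo --> y.
    have -> : f \o x_ = (y_ \o phi) \o psi by apply/funext => k; exact: fx.
    by apply: cvg_comp yphi; exact: increasing_seq_cvgn.
  exact: (cvg_unique Yh fxx fxy').
have bx : boundary (f @^-1` [set y]) x.
  split; first by apply: subset_closure.
  move=> xint; have [N _ /(_ N (leqnn N)) /= fN] := xx _ xint.
  by apply: (phiP (psi N)); left; rewrite -[LHS](fx N).
have [N _ /(_ N (leqnn N)) /= UN] := xx _ (open_nbhs_nbhs (conj Uo (bU _ bx))).
by apply: (phiP (psi N)); right; exists (x_ N) => //; exact: fx.
Qed.

Lemma sequentially_quotient_pseudo_sequence_covering (X Y : topologicalType)
    (f : X -> Y) :
  hausdorff_space Y -> continuous f -> set_surj [set: X] [set: Y] f ->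
  boundary_compact f ->
  (forall K : set X, compact K -> exists G, outer_base K G) ->
  sequentially_quotient f -> pseudo_sequence_covering f.
Proof.
move=> Yh fc fsurj bc outer sq y_ [y yy].
(* The boundary of the fiber may be empty; [a] guarantees a point over [y] and also serves as [x_ n]
   whenever [y_ n = y]. *)
have [a _ fa] := fsurj y I.
pose B := boundary (f @^-1` [set y]).
have [G /outer_base_decreasing[H [Ho BH Hbase] Hdec]] := outer _ (bc y).
have fB : B `<=` f @^-1` [set y].
  have /closure_id -> // : closed (f @^-1` [set y]).
    apply: preimage_closed => //.
    exact/accessible_closed_set1/hausdorff_accessible.
  by move=> x [].
(* [x_ n] lies in [H i] for the largest [i <= n] such that [H i] meets the fiber
   over [y_ n]. *)
have /choice[x_ xP] n : exists x, [/\ f x = y_ n, y_ n = y -> x = a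
    & forall i, i <= n -> y_ n <> y -> (exists2 x', f x' = y_ n & H i x') ->
      H i x].
  have [yny|yny] := pselect (y_ n = y); first by exists a; split; rewrite ?yny.
  suff [x fx xH] : exists2 x, f x = y_ n & forall i, i <= n ->
      (exists2 x', f x' = y_ n & H i x') -> H i x.
    by exists x; split=> // i iin _; exact: xH.
  (* Induction on the bound for [i] alone, with [y_ n] fixed: a point in [H m.+1] serves every
     smaller [i], and if there is none the previous point is kept. *)
  elim: {2}n => [|m [x fx xH]].
    have [[x fx Hx]|nH] := pselect (exists2 x, f x = y_ n & H 0 x).
      by exists x => // i; rewrite leqn0 => /eqP ->.
    have [x _ fx] := fsurj (y_ n) I; exists x => // i.
    by rewrite leqn0 => /eqP -> /nH.
  have [[x' fx' Hx']|nH] := pselect (exists2 x, f x = y_ n & H m.+1 x).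
    by exists x' => // i im _; exact: Hdec im _ Hx'.
  exists x => // i; rewrite leq_eqVlt => /predU1P[-> /nH //|im].
  exact: xH.
have Kc : compact ((B `|` [set a]) `|` range x_).
  apply: compactU_range; first by apply: compactU; [exact: bc|exact: compact_set1].
  move=> U Uo BaU.
  have [|i HU] := Hbase U Uo; first by move=> x Bx; apply: BaU; left.
  have [N _ NP] := fiber_near_boundary Yh fc sq yy (Ho i) (BH i).
  (* From [N] on, the fiber over [y_ n <> y] meets [H i]; from [i] on, [x_ n] is then chosen in
     [H i]. *)
  exists (maxn i N) => // n; rewrite /= geq_max => /andP[iin Nn].
  have [_ xa xH] := xP n.
  have [yny|yny] := pselect (y_ n = y); first by rewrite xa //; apply: BaU; right.
  by apply/HU/xH => //; case: (NP n Nn).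
exists ((B `|` [set a]) `|` range x_) => //.
have fxy n : f (x_ n) = y_ n by have [] := xP n.
apply/seteqP; split.
  have cly : closure (range y_) y.
    move=> V /yy[N _ NV]; exists (y_ N); split; first by exists N.
    exact: (NV N (leqnn N)).
  move=> _ [x [[/fB ->|->]|[n _ <-]] <-] //; first by rewrite fa.
  by rewrite fxy; apply: subset_closure; exists n.
(* As a compact subset of the Hausdorff space [Y], the image is closed, so it contains the closure
   of the [y_ n]. *)
have /closure_id -> : closed (f @` ((B `|` [set a]) `|` range x_)).
  apply: compact_closed => //; apply: continuous_compact => //.
  exact: continuous_subspaceT.
apply: closure_subset => _ [n _ <-]; exists (x_ n); last exact: fxy.
by right; exists n.
Qed.

Theorem corollary3p12 (X Y : topologicalType) (f : X -> Y)
    (X_hausdorff : hausdorff_space X) (Y_hausdorff : hausdorff_space Y)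
    (f_continuous : continuous f) (f_surjective : set_surj [set: X] [set: Y] f)
    (f_boundary_compact : boundary_compact f)
    (X_base : has_point_countable_base X \/ developable X) :
  sequentially_quotient f <-> pseudo_sequence_covering f.
Proof.
have outer (K : set X) : compact K -> exists G, outer_base K G.
  case: X_base => [Xb|Xd]; first exact: point_countable_base_compact_outer_base.
  exact: developable_compact_outer_base.
split; first exact: sequentially_quotient_pseudo_sequence_covering.
apply: pseudo_sequence_covering_sequentially_quotient => x.
exact/outer/compact_set1.
Qed.
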